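(* Fix $k\le n$. Let $S=\{sr^{a_1},\dots,sr^{a_k}\}\subseteq D_{2n}$ be a generating set of distinct reflections. Let $M_{a_j}=\bigl\{\{r^i,\,sr^{a_j-i}\}: i\in\mathbb{Z}_n\bigr\}$ be a collection of edges for each $j\in\{1,\dots,k\}$, and let $\Gamma=\mathrm{Cay}(D_{2n},S)$. Then the following hold: (1) Each $M_{a_j}$ is a perfect matching between $R_n$ and $F_n$. (2) The matchings $M_{a_j}$ and $M_{a_\ell}$ are edge-disjoint whenever $a_j\not\equiv a_\ell \pmod n$. (3) $\Gamma$ is bipartite with bipartitions $R_n$ and $F_n$, and its edge set decomposes as $E(\Gamma)=\bigcup_{j=1}^k M_{a_j}$, the disjoint union of $k$ perfect matchings.
   Context: $D_{2n}=\langle r,s\mid r^n=e,\ s^2=e,\ srs=r^{-1}\rangle$ is the dihedral group of order $2n$; $R_n=\{r^i:i\in\mathbb{Z}_n\}$ is the set of all rotations and $F_n=\{sr^i:i\in\mathbb{Z}_n\}$ is the set of all reflections, so $D_{2n}=R_n\cup F_n$; $\mathbb{Z}_n$ is the cyclic group of order $n$, and indices of rotations and reflections are taken modulo $n$. For a group $G$ and an inverse-closed subset $S\subseteq G\setminus\{e\}$ (that is, $S=S^{-1}$), the undirected Cayley graph $\mathrm{Cay}(G,S)$ is the graph with vertex set $G$ in which vertices $u$ and $v$ are adjacent if and only if $uv^{-1}\in S$. $E(\Gamma)$ denotes the edge set of $\Gamma$. A matching is a set of edges no two of which share a vertex; it is a perfect matching if every vertex is incident with exactly one of its edges, and it is between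 $R_n$ and $F_n$ if each of its edges joins an element of $R_n$ to an element of $F_n$.
   Formalization: The Cayley graph is taken with u, v adjacent iff u^{-1}v ∈ S instead of uv^{-1} ∈ S; with the latter and M_{a_j} as printed, (3) fails, e.g. n=3, S={s,sr}, where {r^2,sr} ∈ M_0 is not an edge. *)

(* Defs.v *)
From HB Require Import structures.
From mathcomp Require Import all_boot all_order all_algebra all_fingroup.

Set Implicit Arguments.
Unset Strict Implicit.
Unset Printing Implicit Defensive.

Import GRing.Theory.

Local Open Scope group_scope.

(* A graph on the finite vertex type T is given by its adjacency relation
   (a boolean relation, symmetric and irreflexive for the graphs at hand). *)
Section Graphs.

Variable T : finType.
Implicit Types (e : rel T) (M : {set {set T}}) (A B : {set T}).

Definition edges e : {set {set T}} :=
  [set [set p.1; p.2] | p : T * T & e p.1 p.2].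

Definition matching e M : Prop :=
  M \subset edges e /\
  (forall E1 E2, E1 \in M -> E2 \in M -> E1 != E2 -> [disjoint E1 & E2]).

Definition perfect_matching e M : Prop :=
  matching e M /\ (forall v : T, exists! E : {set T}, E \in M /\ v \in E).

Definition between A B M : Prop :=
  forall E, E \in M -> exists x y, [/\ x \in A, y \in B & E = [set x; y]].

Definition bipartition e A B : Prop :=
  [/\ A :|: B = [set: T], [disjoint A & B]
    & forall x y, e x y -> (x \in A) && (y \in B) || (x \in B) && (y \in A)].

End Graphs.

Section Cayley.

Variables (gT : finGroupType) (S : {set gT}).

(* The convention is u^-1 * v \in S, i.e. v = u * x for some x \in S, so that
   x = s r^a joins r^i to s r^(a - i), as in rot_refl_edges below. With
   u * v^-1 \in S it would join r^i to s r^(a + i) instead. The two Cayley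
   graphs are exchanged by inversion: see cay_inv. *)
Definition cay : rel gT := [rel u v | u^-1 * v \in S].

Lemma cay_inv u v : cay u^-1 v^-1 = (u * v^-1 \in S).
Proof. by rewrite /cay /= invgK. Qed.

Lemma cay_sym : S^-1 = S -> symmetric cay.
Proof. by move=> SV u v; rewrite /cay /= -{1}SV mem_invg invMg invgK. Qed.

Lemma cay_irr : 1 \notin S -> irreflexive cay.
Proof. by move=> S1 u; rewrite /cay /= mulVg (negPf S1). Qed.

End Cayley.

Section Dihedral.

Variables (gT : finGroupType) (n : nat) (r s : gT).

(* gT is the group < r, s | r^n = 1, s^2 = 1, s r s = r^-1 >, with r and s the
   two distinguished generators. The library type 'D_(2n) requires n > 1, hence
   the presentation. *)
Definition dihedral : Prop :=
  [/\ [set: gT] \isog Grp (x : y : x ^+ n, y ^+ 2, y * x * y = x^-1),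
      <<[set r; s]>> = [set: gT]
    & [/\ r ^+ n = 1, s ^+ 2 = 1 & s * r * s = r^-1]].

Definition rotation (i : int) : gT :=
  match i with Posz m => r ^+ m | Negz m => r ^- m.+1 end.

Definition reflection (i : int) : gT := s * rotation i.

Definition rotations : {set gT} := [set rotation i | i : 'I_n].

Definition reflections : {set gT} := [set reflection i | i : 'I_n].

Definition rot_refl_edges (a : int) : {set {set gT}} :=
  [set [set rotation i; reflection (a - Posz i)%R] | i : 'I_n].

End Dihedral.

(* Main.v *)
Require Import Defs.
From HB Require Import structures.
From mathcomp Require Import all_boot all_order all_algebra all_fingroup.
From mathcomp Require Import cyclic extremal zify.

Set Implicit Arguments.
Unset Strict Implicit.
Unset Printing Implicit Defensive.

Import GRing.Theory.

Local Open Scope group_scope.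

(** The statement is about a subgroup R of index 2 and involutions outside it.
    Right multiplication by such an involution t is a fixed-point-free
    involution of the whole group that exchanges R and its complement, so its
    orbits {v, v t} form a perfect matching between the two ([coset_matching]).
    An edge {v, v t} of this matching determines t as the quotient of its
    ends, whence distinct involutions give disjoint matchings; and an edge
    {u, v} of the Cayley graph of S is by definition {u, u t} with
    t = u^-1 v in S, whence these matchings exhaust the edges.

    In the dihedral group, R is the cyclic group of rotations. Since s inverts
    rotations, s r^(a - i) = r^i (s r^a), so the edges indexed by a are exactly
    the coset matching of t = s r^a ([rot_refl_edgesE]). What remains is that
    the presentation does not collapse: r has order n and <r> has index 2
    ([dihedral_order_index]). The group maps onto a concrete dihedral group of
    order 2n by the universal property of the presentation, while
    <r><s> has at most 2n elements; both bounds are therefore attained. The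
    order of r also gives that s r^a determines a modulo n. *)

(** * Matchings between the cosets of a subgroup of index two *)

Section IndexTwo.

Variables (gT : finGroupType) (R : {group gT}).
Hypothesis indR : #|[set: gT] : R| = 2.

Definition coset_matching (t : gT) : {set {set gT}} :=
  [set [set x; x * t] | x in R].

Lemma index2_mulr_in (t v : gT) : t \notin R -> (v * t \in R) = (v \notin R).
Proof.
move=> tR; have [vR | vR] := boolP (v \in R).
  by rewrite groupMl ?(negPf tR).
have /setP/(_ t^-1) : R :* v = [set: gT] :\: R.
  by apply: rcoset_index2; rewrite ?subsetT // !inE vR.
by rewrite mem_rcoset !inE groupV tR -invMg groupV.
Qed.

(** Multiplication by t being involutive, an edge looks the same from both of
    its ends; this spares the distinction between ends in R and outside R. *)
Lemma coset_edge_at (t v : gT) (E : {set gT}) :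
  t * t = 1 -> E \in coset_matching t -> v \in E -> E = [set v; v * t].
Proof.
move=> t2 /imsetP[x _ ->] /set2P[] -> //.
by rewrite -mulgA t2 mulg1 setUC.
Qed.

Lemma mem_coset_edge (t v : gT) :
  t * t = 1 -> t \notin R -> [set v; v * t] \in coset_matching t.
Proof.
move=> t2 tR; have [vR | vR] := boolP (v \in R); first exact: imset_f.
apply/imsetP; exists (v * t); first by rewrite index2_mulr_in.
by rewrite -mulgA t2 mulg1 setUC.
Qed.

Lemma coset_matching_perfect (S : {set gT}) (t : gT) :
  t * t = 1 -> t \notin R -> t \in S ->
  perfect_matching (cay S) (coset_matching t).
Proof.
move=> t2 tR tS; split; last first.
  move=> v; exists [set v; v * t]; split.
    by rewrite mem_coset_edge // set21.
  by move=> E [ME vE]; rewrite (coset_edge_at t2 ME vE).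
split.
  apply/subsetP=> E /imsetP[x _ ->].
  by apply/imsetP; exists (x, x * t); rewrite // inE /cay /= mulKg.
move=> E1 E2 M1 M2; apply: contraR => /pred0Pn[v /andP[/= v1 v2]].
by rewrite (coset_edge_at t2 M1 v1) (coset_edge_at t2 M2 v2).
Qed.

Lemma coset_matching_between (t : gT) :
  t \notin R -> between R (~: R) (coset_matching t).
Proof.
move=> tR E /imsetP[x xR ->]; exists x, (x * t); split=> //.
by rewrite inE index2_mulr_in // xR.
Qed.

(** The end x in R of an edge fixes it in both matchings, and then its other
    end is both x t and x u. *)
Lemma coset_matching_disjoint (t u : gT) :
  t \notin R -> u * u = 1 -> t != u ->
  [disjoint coset_matching t & coset_matching u].
Proof.
move=> tR u2 tu; apply/pred0Pn=> -[E /andP[/= /imsetP[x xR ->]]] Mu.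
have /setP/(_ (x * t)) := coset_edge_at u2 Mu (set21 x (x * t)).
rewrite set22 !inE (inj_eq (mulgI x)) (negPf tu) orbF => /esym/eqP xt.
by move: tR; rewrite -(groupMl t xR) xt xR.
Qed.

Section Connection.

Variable S : {set gT}.
Hypothesis SR : {in S, forall t, t \notin R}.

Lemma cay_index2_bipartition : bipartition (cay S) R (~: R).
Proof.
split; first by rewrite setUCr.
  by rewrite -setI_eq0 setICr.
move=> x y; rewrite /cay /= => /SR /(index2_mulr_in x).
by rewrite mulKVg !inE => ->; case: (x \in R).
Qed.

Lemma cay_index2_edges :
  {in S, forall t, t * t = 1} ->
  edges (cay S) = \bigcup_(t in S) coset_matching t.
Proof.
move=> S2; apply/setP=> E; apply/imsetP/bigcupP.
  case=> -[u v]; rewrite inE /cay /= => tS ->.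
  exists (u^-1 * v) => //.
  by have := mem_coset_edge u (S2 _ tS) (SR tS); rewrite mulKVg.
case=> t tS /imsetP[x _ ->].
by exists (x, x * t); rewrite // inE /cay /= mulKg.
Qed.

End Connection.

End IndexTwo.

(** * The order of the group defined by the presentation *)

(** The presentation makes every group with generators that satisfy the
    relations a quotient of this one, so a model of order 2n suffices. It is
    'D_(2n) for n > 1. For n = 1, outside the range where 'D_m is dihedral of
    order m, it is the integers modulo 2, with 0 as the rotation and 1 as the
    reflection. *)
Lemma dihedral_lower_bound (gT : finGroupType) (n : nat) (r s : gT) :
  0 < n -> dihedral n r s -> n.*2 <= #|[set: gT]|.
Proof.
move=> n_gt0 [isoG _ _]; case: n n_gt0 isoG => [|[|n]] // _ isoG.
  suff homG: [set: 'Z_2] \homg [set: gT].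
    have := dvdn_leq (cardG_gt0 _) (card_homg homG).
  by rewrite [#|[set: 'Z_2]|]cardsT card_ord.
  rewrite isoG; apply/existsP; exists (1, Zp1) => /=.
  rewrite !xpair_eqE /=; apply/andP; split; last by apply/eqP/val_inj.
  rewrite eqEsubset subsetT; apply/subsetP=> z _.
  suff /cycleP[m ->]: z \in <[Zp1 : 'Z_2]>.
    by rewrite groupX // mem_gen // inE cycle_id orbT.
  by apply/cycleP; exists z; rewrite Zp_expg; apply/val_inj; case: z => [[|[|]]].
suff homG: [set: 'D_(n.+2.*2)] \homg [set: gT].
  have := dvdn_leq (cardG_gt0 _) (card_homg homG).
  by rewrite card_dihedral.
have /existsP[[x y] /=] := isoGrp_hom (Grp_dihedral (isT : 1 < n.+2)).
rewrite !xpair_eqE /= => /and4P[genD xn y2 /eqP xy].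
rewrite isoG; apply/existsP; exists (x, y) => /=.
rewrite !xpair_eqE /= genD xn y2 -xy conjgE /=.
by move: y2; rewrite expgS expg1 -eq_invg_mul => /eqP ->; rewrite mulgA.
Qed.

(** The relations bound the order of <r><s> by that of the group from above,
    and the universal property bounds it from below by the same number. *)
Lemma dihedral_order_index (gT : finGroupType) (n : nat) (r s : gT) :
  0 < n -> dihedral n r s -> #[r] = n /\ #|[set: gT] : <[r]>| = 2.
Proof.
move=> n_gt0 dih; have := dihedral_lower_bound n_gt0 dih.
case: dih => _ genG [rn s2 srs].
have le_r : #[r] <= n by rewrite dvdn_leq // order_dvdn rn.
have le_s : #[s] <= 2 by rewrite dvdn_leq // order_dvdn s2.
have sV : s^-1 = s by apply/eqP; rewrite eq_invg_mul -expg2 s2.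
have defG : <[r]> * <[s]> = [set: gT].
  rewrite -norm_joinEr; first by rewrite -genG joing_idl joing_idr.
  by rewrite cycle_subG; apply/normP; rewrite -cycleJ conjgE sV mulgA srs cycleV.
have := mul_cardG <[r]> <[s]>; rewrite defG -!orderE => oG ge_G.
have I_gt0 := cardG_gt0 (<[r]> :&: <[s]>).
have le_G : #|[set: gT]| <= #[r] * #[s] by rewrite oG leq_pmulr.
have or : #[r] = n.
  apply/eqP; rewrite eqn_leq le_r -(@leq_pmul2r 2) // muln2.
  by rewrite (leq_trans ge_G) // (leq_trans le_G) // leq_mul.
split=> //; apply/eqP; rewrite -(eqn_pmul2l n_gt0) -{1}or.
rewrite orderE Lagrange ?subsetT // muln2 eqn_leq ge_G andbT.
by rewrite (leq_trans le_G) // or -muln2 leq_mul.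
Qed.

(** * Rotations and reflections indexed by integers *)

Section Indices.

Variables (gT : finGroupType) (n : nat) (r s : gT).
Hypotheses (n_gt0 : 0 < n) (rn : r ^+ n = 1).

(** Reducing the index modulo n turns negative powers into positive ones, so
    that the laws of natural exponents apply to rotations. *)
Lemma rotation_modz (i : int) : rotation r i = r ^+ `|(i %% n)%Z|.
Proof.
case: i => m /=; first by rewrite modz_nat /= expg_mod.
rewrite modNz_nat //; apply/eqP; rewrite eq_invg_mul.
have lt_m := ltn_pmod m n_gt0.
have -> : (Posz n - 1 - Posz (m %% n))%R = (n - (m %% n).+1)%N by lia.
rewrite -expgD -(expg_mod _ rn) /= -modnDml -addn1 -(modnDml m) addn1.
by rewrite modnDml subnKC // modnn.
Qed.

Lemma rotationD (i j : int) : rotation r (i + j) = rotation r i * rotation r j.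
Proof.
have n_neq0 : Posz n != 0%R by rewrite eqz_nat -lt0n.
rewrite !rotation_modz -expgD -[RHS](expg_mod _ rn) -modzDm.
have := modz_ge0 j n_neq0; have := modz_ge0 i n_neq0.
case: (i %% n)%Z => // p _; case: (j %% n)%Z => // q _.
by rewrite -PoszD modz_nat.
Qed.

Lemma rotationN (i : int) : rotation r (- i) = (rotation r i)^-1.
Proof. by apply/eqP; rewrite eq_sym eq_invg_mul -rotationD subrr. Qed.

Lemma rotation_in_cycle (i : int) : rotation r i \in <[r]>.
Proof. by rewrite rotation_modz mem_cycle. Qed.

Lemma rotation_inj_modz (i j : int) :
  #[r] = n -> rotation r i = rotation r j -> (i = j %[mod n])%Z.
Proof.
move=> or; have n_neq0 : Posz n != 0%R by rewrite eqz_nat -lt0n.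
rewrite !rotation_modz => /eqP; rewrite eq_expg_mod_order or.
have := modz_ge0 i n_neq0; have := modz_ge0 j n_neq0.
have := ltz_pmod i (n_gt0 : (0 < Posz n)%R).
have := ltz_pmod j (n_gt0 : (0 < Posz n)%R).
case: (i %% n)%Z => // p; case: (j %% n)%Z => // q.
by rewrite !ltz_nat /= => lt_q lt_p _ _; rewrite !modn_small // => /eqP ->.
Qed.

Lemma rotations_cycle : #[r] = n -> rotations n r = <[r]>.
Proof.
move=> or; apply/setP=> x; apply/imsetP/idP=> [[i _ ->] | /cyclePmin[i]].
  exact: mem_cycle.
by rewrite or => lt_i ->; exists (Ordinal lt_i).
Qed.

Section Reflections.

Hypotheses (s2 : s ^+ 2 = 1) (srs : s * r * s = r^-1).

Lemma conj_refl_rotation (x : gT) : x \in <[r]> -> x * s = s * x^-1.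
Proof.
have sV : s^-1 = s by apply/eqP; rewrite eq_invg_mul -expg2 s2.
case/cycleP=> m ->; rewrite [LHS]conjgC conjXg conjgE sV mulgA srs.
by rewrite expgVn.
Qed.

Lemma reflection_sqr (i : int) : reflection r s i * reflection r s i = 1.
Proof.
rewrite /reflection mulgA -(mulgA s) conj_refl_rotation ?rotation_in_cycle //.
by rewrite mulgA -expg2 s2 mul1g mulVg.
Qed.

(** Moving r^i across s inverts it: r^i (s r^a) = s r^(-i) r^a = s r^(a - i). *)
Lemma rot_refl_edgesE (a : int) :
  #[r] = n ->
  rot_refl_edges n r s a = coset_matching <[r]>%G (reflection r s a).
Proof.
move=> or; rewrite /coset_matching /= -(rotations_cycle or) -imset_comp.
apply: eq_imset => i /=; congr [set _; _].
rewrite /reflection mulgA conj_refl_rotation ?mem_cycle //.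
by rewrite addrC rotationD rotationN mulgA.
Qed.

Hypothesis indR : #|[set: gT] : <[r]>| = 2.
Hypothesis genG : <<[set r; s]>> = [set: gT].

(** If a reflection were a rotation, so would be s, and the rotations would be
    the whole group. *)
Lemma reflection_notin_cycle (i : int) : reflection r s i \notin <[r]>.
Proof.
rewrite /reflection groupMr ?rotation_in_cycle //.
apply/negP=> sR; move: indR; rewrite (_ : [set: gT] = <[r]>) ?indexgg //.
apply/eqP; rewrite eqEsubset subsetT -genG gen_subG subUset !sub1set.
by rewrite cycle_id sR.
Qed.

Lemma reflections_compl : #[r] = n -> reflections n r s = ~: <[r]>.
Proof.
move=> or; have sR : s \notin <[r]>.
  by have := reflection_notin_cycle 0; rewrite /reflection mulg1.
apply/setP=> x; rewrite inE; apply/imsetP/idP => [[i _ ->] | xR].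
  exact: reflection_notin_cycle.
have : s^-1 * x \in <[r]>.
  by rewrite (index2_mulr_in indR _ xR) groupV.
case/cyclePmin=> i; rewrite or => lt_i sx; exists (Ordinal lt_i) => //.
by rewrite /reflection /= -sx mulKVg.
Qed.

End Reflections.

End Indices.

(** * The decomposition of the Cayley graph *)

Theorem proposition4p2 (gT : finGroupType) (n k : nat) (r s : gT)
    (a : 'I_k -> int) (S : {set gT})
    (n_gt0 : (0 < n)%N)
    (dih : dihedral n r s)
    (le_kn : (k <= n)%N)
    (a_distinct : injective (fun j : 'I_k => reflection r s (a j)))
    (defS : S = [set reflection r s (a j) | j : 'I_k])
    (genS : <<S>> = [set: gT]) :
  [/\ (forall j : 'I_k,
         perfect_matching (cay S) (rot_refl_edges n r s (a j)) /\
         between (rotations n r) (reflections n r s)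
           (rot_refl_edges n r s (a j))),
      (forall j l : 'I_k, ~ (a j = a l %[mod n])%Z ->
         [disjoint rot_refl_edges n r s (a j) & rot_refl_edges n r s (a l)])
    & [/\ bipartition (cay S) (rotations n r) (reflections n r s),
          edges (cay S) = \bigcup_(j : 'I_k) rot_refl_edges n r s (a j),
          (forall j l : 'I_k, j != l ->
             [disjoint rot_refl_edges n r s (a j)
                     & rot_refl_edges n r s (a l)])
        & (forall j : 'I_k,
             perfect_matching (cay S) (rot_refl_edges n r s (a j)))]].
Proof.
have [or indR] := dihedral_order_index n_gt0 dih.
case: dih => _ genG [rn s2 srs].
have t2 := reflection_sqr n_gt0 rn s2 srs.
have tR := reflection_notin_cycle n_gt0 rn indR genG.
have edgesE b := rot_refl_edgesE n_gt0 rn s2 srs b or.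
have perfect j : perfect_matching (cay S) (rot_refl_edges n r s (a j)).
  rewrite edgesE; apply: coset_matching_perfect => //.
  by rewrite defS; apply/imsetP; exists j.
have disj b c : reflection r s b <> reflection r s c ->
    [disjoint rot_refl_edges n r s b & rot_refl_edges n r s c].
  by move=> /eqP neq; rewrite !edgesE coset_matching_disjoint.
have SR : {in S, forall t, t \notin <[r]>}.
  by move=> t; rewrite defS => /imsetP[j _ ->].
rewrite (rotations_cycle or) (reflections_compl n_gt0 rn indR genG or).
split=> [j | j l neq | ].
- by split; rewrite ?edgesE; [rewrite -edgesE | apply: coset_matching_between].
- by apply: disj => /mulgI /(rotation_inj_modz n_gt0 rn or).
split=> // [||j l neq].
- exact: cay_index2_bipartition.
- rewrite (cay_index2_edges indR SR) => [|t]; last first.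
    by rewrite defS => /imsetP[j _ ->].
  rewrite defS big_imset /=; last by move=> j l _ _; apply: a_distinct.
  by apply: eq_bigr => j _; rewrite edgesE.
by apply: disj => /a_distinct eq_jl; rewrite eq_jl eqxx in neq.
Qed.
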